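(* Let $n\ge 1$, and let $(\mathbf{a}_1,\ldots,\mathbf{a}_k)$ be a tuple of non-trivial symmetric compositions of the same number $2n$. If $(\mathbf{a}_1,\ldots,\mathbf{a}_k)$ is of symplectic finite type, then $k\le 3$.
   Context: All vector spaces are over a fixed algebraically closed field. A composition of a positive integer $m$ is a sequence of non-negative integers $\mathbf{a}=(a_1,\ldots,a_p)$ with sum $m$; the $a_i$ are its parts. Its opposite is $\mathbf{a}^{\mathrm{op}}=(a_p,\ldots,a_1)$, and $\mathbf{a}$ is symmetric if $\mathbf{a}=\mathbf{a}^{\mathrm{op}}$. A composition of $2n$ is trivial if it has only one non-zero part (so that the corresponding flag variety is a point); otherwise it is non-trivial. For a vector space $V$ of dimension $m$, $\mathrm{Fl}_{\mathbf{a}}(V)$ is the variety of flags $A=(0=A_0\subset A_1\subset\cdots\subset A_p=V)$ with $\dim(A_i/A_{i-1})=a_i$ for all $i$. Let $V$ be a $2n$-dimensional vector space with a non-degenerate alternating bilinear form $\langle\,,\,\rangle$, and let $\mathrm{Sp}(V)$ be the group of linear automorphisms of $V$ preserving the form. For a symmetric composition $\mathbf{a}=(a_1,\dots,a_p)$ of $2n$, $$\mathrm{SpFl}_{\mathbf{a}}(V)=\{A\in \mathrm{Fl}_{\mathbf{a}}(V)\mid \langle A_i,A_{p-i}\rangle=0 \text{ for all } i\}.$$ A tuple $\mathbf{d}=(\mathbf{a}_1,\ldots,\mathbf{a}_k)$ of symmetric compositions of $2n$ is of symplectic finite type ($\mathrm{Sp}$-finite) if $\mathrm{Sp}(V)$,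 acting diagonally, has finitely many orbits in $\mathrm{SpFl}_{\mathbf{d}}(V)=\mathrm{SpFl}_{\mathbf{a}_1}(V)\times\cdots\times \mathrm{SpFl}_{\mathbf{a}_k}(V)$. *)

(* Defs.v *)
From mathcomp Require Import all_boot all_algebra.
From mathcomp Require Import classical_sets cardinality.

Set Implicit Arguments.
Unset Strict Implicit.
Unset Printing Implicit Defensive.

Import GRing.Theory.
Local Open Scope ring_scope.
Local Open Scope classical_set_scope.

Definition composition_of (m : nat) (a : seq nat) : Prop := sumn a = m.

Definition symmetric_comp (a : seq nat) : Prop := a = rev a.

Definition trivial_comp (a : seq nat) : Prop :=
  count (fun x => x != 0%N) a = 1%N.

Section SymplecticFlags.
Variables (F : closedFieldType) (V : vectType F) (form : {biscalar V}).

(* Not "skew-symmetric", which is weaker in characteristic 2. *)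
Definition alternating_form : Prop := forall u, form u u = 0.

Definition nondegenerate_form : Prop :=
  forall u, (forall v, form u v = 0) -> u = 0.

(* Since V is finite-dimensional, a trivial kernel makes g bijective. *)
Definition Sp : set 'End(V) :=
  [set g | lker g = 0%VS /\ forall u v, form (g u) (g v) = form u v].

(* A flag for a = (a_1, ..., a_p) is the sequence A_0, ..., A_p of its p + 1
   subspaces; the part a_(i+1) is nth 0 a i. *)
Definition Fl (a : seq nat) : set (seq {vspace V}) :=
  [set A | [/\ size A = (size a).+1,
               nth 0%VS A 0 = 0%VS,
               nth 0%VS A (size a) = fullv
             & forall i, (i < size a)%N ->
                 (nth 0%VS A i <= nth 0%VS A i.+1)%VS
                 /\ \dim (nth 0%VS A i.+1)
                    = (\dim (nth 0%VS A i) + nth 0%N a i)%N]].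

Definition SpFl (a : seq nat) : set (seq {vspace V}) :=
  [set A | Fl a A /\
           forall i, (i <= size a)%N ->
             {in nth 0%VS A i & nth 0%VS A (size a - i),
               forall u v, form u v = 0}].

Definition SpFl_prod k (d : k.-tuple (seq nat)) :
    set (k.-tuple (seq {vspace V})) :=
  [set A | forall j, SpFl (tnth d j) (tnth A j)].

Definition flags_act k (g : 'End(V)) (A : k.-tuple (seq {vspace V})) :
    k.-tuple (seq {vspace V}) :=
  [tuple [seq (g @: U)%VS | U <- tnth A j] | j < k].

Definition Sp_orbit k (A : k.-tuple (seq {vspace V})) :
    set (k.-tuple (seq {vspace V})) :=
  [set flags_act g A | g in Sp].

Definition Sp_finite k (d : k.-tuple (seq nat)) : Prop :=
  finite_set [set Sp_orbit A | A in SpFl_prod d].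

End SymplecticFlags.

(* Main.v *)
(** A non-trivial symmetric composition of [2n] has a partial sum [r] with
    [1 <= r <= n], so each of its flags contains an isotropic subspace of
    dimension [r].  Fix a hyperbolic pair [(e, f)] and independent vectors [w]
    spanning a Lagrangian subspace of the orthogonal complement of [<e, f>].
    For four compositions, and [t] in the field, take complete isotropic flags
    starting with the lines [e], [f], [e + f], [e + t f] and continuing along
    [w].  An element of [Sp] carrying the flags for [t] to those for [t']
    preserves, modulo [<w>], the four lines in the plane [<e, f>], so their
    cross-ratio gives [t = t'].  The field being infinite, so is the set of
    orbits. *)
Require Import Defs.
From HB Require Import structures.
From mathcomp Require Import all_boot all_algebra.
From mathcomp Require Import boolp classical_sets cardinality.
From mathcomp Require Import zify ring.

Set Implicit Arguments.
Unset Strict Implicit.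
Unset Printing Implicit Defensive.

Import GRing.Theory.
Local Open Scope ring_scope.

(** If [s] listed the whole field, the product of the ['X - z%:P] would be a non-zero polynomial
    without a non-root. *)
Lemma infinite_closedField (F : closedFieldType) :
  ~ finite_set (@setT F).
Proof.
move=> /finite_seqP[s sE].
have /closed_nonrootP[x] : \prod_(z <- s) ('X - z%:P) != 0 :> {poly F}.
  exact/monic_neq0/monic_prod_XsubC.
rewrite root_prod_XsubC => /negP; apply.
by have : setT x by []; rewrite sE.
Qed.

(** * Partial sums of symmetric compositions *)

Section Compositions.
Local Open Scope nat_scope.

Lemma sumn_take_sub (a : seq nat) i : symmetric_comp a -> i <= size a ->
  sumn (take (size a - i) a) = sumn a - sumn (take i a).
Proof.
move=> asym ile; rewrite {2}asym take_rev subKn // sumn_rev.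
by rewrite -{2}(cat_take_drop i a) sumn_cat addKn.
Qed.

Lemma sumn_eq0 (a : seq nat) : (sumn a == 0) = (count (fun x => x != 0) a == 0).
Proof. by elim: a => //= -[|x] a /=. Qed.

(** The first non-zero part [x] is a partial sum. If [x > n], symmetry makes [2 * n - x] one too; it
    is below [n], and positive because another part is non-zero. *)
Lemma symmetric_partial_sum n (a : seq nat) : 0 < n ->
    composition_of (2 * n) a -> symmetric_comp a -> ~ trivial_comp a ->
  exists2 i, i <= size a & 0 < sumn (take i a) <= n.
Proof.
move=> n_gt0 asum asym antriv.
have ahas : has (fun x => x != 0) a.
  by rewrite has_count lt0n -sumn_eq0 asum; lia.
case: (split_find ahas) asum asym antriv => x p q xn0 /hasPn pn0.
rewrite /composition_of /symmetric_comp /trivial_comp => asum asym antriv.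
have /eqP cp0 : count (fun x => x != 0) p == 0.
  by rewrite -leqn0 leqNgt -has_count; apply/hasPn.
have sp : sumn p = 0 by apply/eqP; rewrite sumn_eq0 cp0.
have tk : sumn (take (size p).+1 (rcons p x ++ q)) = x.
  by rewrite take_size_cat ?size_rcons // sumn_rcons sp.
have sq : 0 < sumn q.
  rewrite lt0n sumn_eq0; apply/eqP => cq; apply: antriv.
  by rewrite count_cat -cats1 count_cat cq cp0 /= xn0.
have ple : (size p).+1 <= size (rcons p x ++ q).
  by rewrite size_cat size_rcons leq_addr.
have sE : sumn (rcons p x ++ q) = x + sumn q by rewrite sumn_cat sumn_rcons sp.
case: (leqP x n) => xn.
  by exists (size p).+1 => //; rewrite tk xn andbT lt0n.
exists (size (rcons p x ++ q) - (size p).+1); first exact: leq_subr.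
by rewrite sumn_take_sub // tk; lia.
Qed.

End Compositions.

(** * Orthogonal complements for an alternating form *)

Section Perp.
Variables (F : fieldType) (V : vectType F) (form : {biscalar V}).
Hypothesis form_alt : forall u, form u u = 0.
Hypothesis form_nd : forall u, (forall v, form u v = 0) -> u = 0.

Lemma form_skew u v : form u v = - form v u.
Proof.
have := form_alt (u + v).
rewrite linearDl !linearDr !form_alt add0r addr0 => /eqP.
by rewrite addr_eq0 => /eqP.
Qed.

Lemma form_eq0C u v : (form u v == 0) = (form v u == 0).
Proof. by rewrite form_skew oppr_eq0. Qed.

Definition pairing (s : seq V) (v : V) : 'rV[F]_(size s) :=
  \row_i form s`_i v.

Lemma pairing_linear s : linear (pairing s).
Proof. by move=> c u v; apply/rowP => i; rewrite !mxE linearPr. Qed.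

HB.instance Definition _ s := GRing.isLinear.Build F V 'rV[F]_(size s) _
  (pairing s) (pairing_linear s).

Definition perp (s : seq V) : {vspace V} := lker (linfun (pairing s)).

Lemma mem_perp s v : (v \in perp s) = all (fun x => form x v == 0) s.
Proof.
rewrite memv_ker lfunE /=; apply/eqP/(all_nthP 0) => [/rowP h i ilt|h].
  by have := h (Ordinal ilt); rewrite !mxE => ->.
by apply/rowP => i; rewrite !mxE; apply/eqP/h.
Qed.

Lemma perpP s v : reflect {in <<s>>%VS, forall x, form x v = 0} (v \in perp s).
Proof.
rewrite mem_perp; apply: (iffP allP) => h x xs; last first.
  by apply/eqP/h/memv_span.
rewrite (coord_span (X := in_tuple s) xs) linear_sumlz big1 // => i _.
by rewrite linearZl_LR (eqP (h _ (mem_nth _ _))) // mulr0.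
Qed.

Lemma dim_capv_perp (U : {vspace V}) s :
  (\dim U <= \dim (U :&: perp s) + size s)%N.
Proof.
rewrite -(limg_ker_dim (linfun (pairing s)) U) leq_add2l.
have := dimvS (subvf (linfun (pairing s) @: U)%VS).
by rewrite dimvf /dim /= mul1n.
Qed.

(** One inequality is [dim_capv_perp] on the whole space. The other is the same bound for [perp s]
    and a basis [b] of a complement of [<<s>>]: by non-degeneracy [perp s] and [perp b] meet in
    zero. *)
Lemma dim_perp s : free s -> (\dim (perp s) = \dim {:V} - size s)%N.
Proof.
move=> sfree; set b := vbasis (<<s>>^C).
have bsize : size b = (\dim {:V} - size s)%N.
  by rewrite size_tuple dimv_compl (eqnP sfree).
have := dim_capv_perp fullv s; rewrite capfv.
have := dim_capv_perp (perp s) b; rewrite bsize.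
suff -> : (perp s :&: perp b)%VS = 0%VS by rewrite dimv0; lia.
apply/eqP; rewrite -subv0; apply/subvP => v.
rewrite memv_cap => /andP[/perpP vs /perpP vb]; rewrite memv0; apply/eqP.
apply: form_nd => u; apply/eqP; rewrite form_eq0C; apply/eqP.
have := memvf u; rewrite -(addv_complf <<s>>%VS) => /memv_addP[x xs [y yb ->]].
by rewrite linearDl vs // vb ?addr0 // (span_basis (vbasisP _)).
Qed.

(** * Isotropic sequences and their complete flags *)

Definition isotropic (s : seq V) := {in s &, forall x y, form x y = 0}.

Lemma isotropic_span s : isotropic s -> (<<s>> <= perp s)%VS.
Proof.
move=> siso; apply/span_subvP => y ys; rewrite mem_perp.
by apply/allP => x xs; apply/eqP/siso.
Qed.

Lemma isotropic_cons v s : v \in perp s -> isotropic s -> isotropic (v :: s).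
Proof.
rewrite mem_perp => /allP vs siso x y; rewrite !inE.
move=> /predU1P[->|xs] /predU1P[->|ys]; first exact: form_alt.
- by apply/eqP; rewrite form_eq0C vs.
- exact/eqP/vs.
- exact: siso.
Qed.

Lemma isotropic_extension s0 m : (2 * m + size s0 <= \dim {:V})%N ->
  exists w : seq V, [/\ size w = m, free w, isotropic w
    & {subset w <= perp s0}].
Proof.
elim: m => [|m IHm] hm; first by exists [::]; split=> //; exact: nil_free.
have [|w [wsize wfree wiso ws0]] := IHm; first lia.
(* A dimension count: [perp (w ++ s0)] has dimension at least [m + 2], while [<<w>>] has dimension
   [m]. *)
have : ~~ (perp (w ++ s0) <= <<w>>)%VS.
  apply/negP => /dimvS; rewrite (eqnP wfree).
  have := dim_capv_perp fullv (w ++ s0); rewrite capfv size_cat; lia.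
case/subvPn => v; rewrite mem_perp all_cat -!mem_perp => /andP[vw vs0] vNw.
exists (v :: w); split; first by rewrite /= wsize.
- by rewrite free_cons vNw.
- exact: isotropic_cons.
- by move=> x; rewrite inE => /predU1P[->|/ws0].
Qed.

(** Meant for a basis [s] of a Lagrangian: the flag climbs along [s] to [<<s>>], then runs through
    the orthogonals of its lower terms, so that index equals dimension. *)
Definition iso_flag (s : seq V) (i : nat) : {vspace V} :=
  if (i <= size s)%N then <<take i s>>%VS else perp (take (2 * size s - i) s).

Section IsoFlag.
Variable s : seq V.
Hypotheses (sfree : free s) (siso : isotropic s).
Hypothesis sdim : \dim {:V} = (2 * size s)%N.

Let take_free i : free (take i s).
Proof. by apply: (@catl_free _ _ (drop i s)); rewrite cat_take_drop. Qed.

Let perp_take i : (perp s <= perp (take i s))%VS.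
Proof.
apply/subvP => v; rewrite !mem_perp => /allP vs.
by apply/allP => x /mem_take/vs.
Qed.

Lemma dim_iso_flag i : (i <= 2 * size s)%N -> \dim (iso_flag s i) = i.
Proof.
rewrite /iso_flag => ile; case: leqP => ilt.
  by rewrite (eqnP (take_free i)) size_take_min; lia.
by rewrite dim_perp // sdim size_take_min; lia.
Qed.

Lemma take_subset i j : (i <= j)%N -> {subset take i s <= take j s}.
Proof. by move=> ij x; rewrite -(subnKC ij) takeD mem_cat => ->. Qed.

Lemma iso_flag_sub i j : (i <= j)%N -> (iso_flag s i <= iso_flag s j)%VS.
Proof.
rewrite /iso_flag => ij; case: (leqP i) => ile; case: (leqP j) => jle.
- exact/sub_span/take_subset.
- apply: subv_trans (perp_take _); apply: subv_trans (isotropic_span siso).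
  by apply: sub_span => x /mem_take.
- by lia.
- apply/subvP => v; rewrite !mem_perp => /allP vs; apply/allP => x xs.
  by apply/vs/(take_subset _ xs); lia.
Qed.

Lemma iso_flag_orth i : (i <= 2 * size s)%N ->
  {in iso_flag s i & iso_flag s (2 * size s - i), forall u v, form u v = 0}.
Proof.
wlog ile : i / (i <= size s)%N => [hw|].
  case: (leqP i (size s)) => [|ilt i2 u v us vs]; first exact: hw.
  apply/eqP; rewrite form_eq0C; apply/eqP.
  by apply: (hw (2 * size s - i)%N); rewrite ?subKn //; lia.
move=> i2 u v us vs; apply: (perpP (take i s) v _) => //; last first.
  by move: us; rewrite /iso_flag ile.
(* Above the middle this is the definition; otherwise [i = size s], and [v] lies in the isotropic
   [<<s>>]. *)
move: vs; rewrite /iso_flag; case: leqP => _; last by rewrite subKn.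
move=> vs; apply: (subvP (perp_take i)); apply: (subvP (isotropic_span siso)).
by apply: (subvP (sub_span _)) vs => x /mem_take.
Qed.

End IsoFlag.

(** Up to the middle, a non-zero term contains the leading vector and lies in the span of that
    vector and [w]. *)
Lemma line_preserved (g : 'End(V)) v v' w r : (0 < r <= (size w).+1)%N ->
    (g @: iso_flag (v :: w) r)%VS = iso_flag (v' :: w) r ->
  exists c, exists2 x, x \in <<w>>%VS & g v = c *: v' + x.
Proof.
case: r => // r /= rle; rewrite /iso_flag /= rle => gE.
have : g v \in <<v' :: w>>%VS.
  apply: (subvP (sub_span _)) (_ : g v \in <<v' :: take r w>>%VS).
    by move=> x; rewrite !inE => /predU1P[->|/mem_take->]; rewrite ?eqxx ?orbT.
  by rewrite -gE memv_img // memv_span // mem_head.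
rewrite span_cons => /memv_addP[_ /vlineP[c ->] [x xw ->]].
by exists c; exists x.
Qed.

End Perp.

(** * Four lines in a hyperbolic plane *)

Section FourLines.
Variables (F : fieldType) (V : vectType F) (form : {biscalar V}).
Hypothesis form_alt : forall u, form u u = 0.
Variables (e f : V) (w : seq V).
Hypotheses (ef1 : form e f = 1) (wfree : free w) (wiso : isotropic form w).
Hypothesis wef : {subset w <= perp form [:: e; f]}.

Let skew := form_skew form_alt.

Let formEw x : x \in <<w>>%VS -> form e x = 0.
Proof.
have /span_subvP/subvP h := wef.
by move/h; rewrite mem_perp /= => /and3P[/eqP].
Qed.

Let formFw x : x \in <<w>>%VS -> form f x = 0.
Proof.
have /span_subvP/subvP h := wef.
by move/h; rewrite mem_perp /= => /and3P[_ /eqP].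
Qed.

Definition plane_vec (a b : F) : V := a *: e + b *: f.

Lemma plane_vec_free a b : (a, b) != 0 -> free (plane_vec a b :: w).
Proof.
move=> ab; rewrite free_cons wfree andbT; apply: contra ab => vw.
have := formEw vw; have := formFw vw; rewrite /plane_vec !linearDr !linearZr_LR.
rewrite !form_alt (skew f e) ef1 /= !mulr0 mulrN !mulr1 addr0 add0r.
by move=> /eqP; rewrite oppr_eq0 => /eqP -> ->.
Qed.

Lemma plane_vec_isotropic a b : isotropic form (plane_vec a b :: w).
Proof.
apply: isotropic_cons => //; rewrite mem_perp; apply/allP => x /memv_span xw.
rewrite form_eq0C // /plane_vec linearDl !linearZl_LR /=.
by rewrite formEw // formFw // !mulr0 addr0.
Qed.

(** The default of [nth] supplies the fourth line for every index from 3 on, which covers tuples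
    longer than four. *)
Definition four_lines (t : F) (j : nat) : V :=
  nth (plane_vec 1 t) [:: plane_vec 1 0; plane_vec 0 1; plane_vec 1 1] j.

Lemma four_lines_plane t j :
  exists2 ab, ab != 0 & four_lines t j = plane_vec ab.1 ab.2.
Proof.
have pair_neq0 (a b : F) : (a != 0) || (b != 0) -> (a, b) != 0.
  by apply: contraTneq => -[-> ->]; rewrite eqxx.
case: j => [|[|[|j]]];
  [exists (1, 0) | exists (0, 1) | exists (1, 1) | exists (1, t)];
  rewrite ?pair_neq0 ?oner_neq0 ?orbT //.
by rewrite /four_lines /= nth_nil.
Qed.

Lemma four_lines_eq (g : 'End(V)) t t' :
    (forall u v, form (g u) (g v) = form u v) ->
    (forall j, (j < 4)%N -> exists c, exists2 x, x \in <<w>>%VS &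
      g (four_lines t j) = c *: four_lines t' j + x) ->
  t = t'.
Proof.
move=> gform h.
have [a [x xw]] := h 0%N isT; have [b [y yw]] := h 1%N isT.
have [c [z zw]] := h 2%N isT; have [d [u uw]] := h 3%N isT.
rewrite /four_lines /plane_vec /= !scale1r !scale0r !addr0 !add0r.
rewrite !linearD !linearZ /= => gt gef gf ge.
have fe1 : form f e = - 1 by rewrite skew ef1.
(* Pairing with [f] and [e] reads off coordinates modulo [<<w>>]. Expanding [g (e + f)] and
   [g (e + t f)] in two ways then compares the scalars. *)
have coordE p q r : r \in <<w>>%VS -> form f (p *: e + q *: f + r) = - p.
  move=> rw; rewrite !linearDr !linearZr_LR /= form_alt fe1 formFw //.
  by ring.
have coordF p q r : r \in <<w>>%VS -> form e (p *: e + q *: f + r) = q.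
  move=> rw; rewrite !linearDr !linearZr_LR /= form_alt ef1 formEw //.
  by ring.
have E1 : a = c.
  apply: oppr_inj; rewrite -(coordE c c z) // -(coordE a b (x + y)) ?memvD //.
  by rewrite -gef ge gf addrACA addrA.
have E2 : b = c.
  rewrite -(coordF c c z) // -(coordF a b (x + y)) ?memvD //.
  by rewrite -gef ge gf addrACA addrA.
have gtE : g e + t *: g f = a *: e + (t * b) *: f + (x + t *: y).
  by rewrite ge gf scalerDr scalerA addrACA addrA.
have E3 : a = d.
  apply: oppr_inj; rewrite -(coordE d (t' * d) u) //.
  rewrite -(coordE a (t * b) (x + t *: y)) ?memvD ?memvZ //.
  by rewrite -gtE gt scalerA.
have E4 : t * b = t' * d.
  rewrite -(coordF d (t' * d) u) //.
  rewrite -(coordF a (t * b) (x + t *: y)) ?memvD ?memvZ //.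
  by rewrite -gtE gt scalerA.
(* If [b = 0], then [a = 0] too, so [g e] and [g f] lie in the isotropic [<<w>>], against
   [form e f = 1]. *)
have bn0 : b != 0.
  apply: contra_eq_neq (gform e f) => b0.
  have a0 : a = 0 by rewrite E1 -E2.
  rewrite ge gf a0 b0 !scale0r !add0r ef1 eq_sym.
  have /subvP/(_ _ yw)/perpP -> // := isotropic_span wiso.
  exact: oner_neq0.
by apply: (mulIf bn0); rewrite E4 -E3 E1 -E2.
Qed.

End FourLines.

(** * Points of symplectic flag varieties from isotropic sequences *)

Section SpFlags.
Variables (F : closedFieldType) (V : vectType F) (form : {biscalar V}).
Hypotheses (form_alt : alternating_form form)
  (form_nd : nondegenerate_form form).

Definition comp_flag (s : seq V) (a : seq nat) : seq {vspace V} :=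
  mkseq (fun i => iso_flag form s (sumn (take i a))) (size a).+1.

Lemma SpFl_comp_flag (s : seq V) (a : seq nat) :
    free s -> isotropic form s -> \dim {:V} = (2 * size s)%N ->
    composition_of (2 * size s) a -> symmetric_comp a ->
  SpFl form a (comp_flag s a).
Proof.
move=> sfree siso sdim asum asym.
have psum i : (sumn (take i a) <= 2 * size s)%N.
  by rewrite -asum -[in leqRHS](cat_take_drop i a) sumn_cat leq_addr.
have dimE i := dim_iso_flag form_alt form_nd sfree sdim (psum i).
split; first split.
- by rewrite size_mkseq.
- by rewrite nth_mkseq //; apply/eqP; rewrite -dimv_eq0 dimE take0.
- rewrite nth_mkseq //; apply/eqP.
  by rewrite eqEdim subvf dimE take_size asum sdim leqnn.
- move=> i ilt; rewrite !nth_mkseq ?ltnS ?(ltnW ilt) // !dimE.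
  by rewrite (take_nth 0%N ilt) sumn_rcons iso_flag_sub ?leq_addr.
- move=> i ile; rewrite !nth_mkseq ?ltnS ?leq_subr //.
  (* By symmetry of [a], the complementary term has index [2 * size s] minus the partial sum. *)
  by rewrite sumn_take_sub // asum; exact: iso_flag_orth.
Qed.

Lemma Sp_orbit_refl k (A : k.-tuple (seq {vspace V})) : Sp_orbit form A A.
Proof.
exists \1%VF.
  by split=> [|u v]; [apply/eqP/lker0P => u v | ]; rewrite !id_lfunE.
apply: eq_from_tnth => j; rewrite tnth_mktuple.
by rewrite (eq_map (fun U => lim1g U)) map_id.
Qed.

End SpFlags.

(** * Infinitely many orbits for four or more flags *)

Theorem theorem1p1 (F : closedFieldType) (n : nat) (hn : (1 <= n)%N)
    (V : vectType F) (dimV : \dim {:V} = (2 * n)%N)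
    (form : {biscalar V})
    (form_alt : alternating_form form) (form_nd : nondegenerate_form form)
    (k : nat) (d : k.-tuple (seq nat))
    (d_comp : forall j : 'I_k, composition_of (2 * n) (tnth d j))
    (d_sym : forall j : 'I_k, symmetric_comp (tnth d j))
    (d_nontriv : forall j : 'I_k, ~ trivial_comp (tnth d j))
    (d_fin : Sp_finite form d) :
  (k <= 3)%N.
Proof.
rewrite leqNgt; apply/negP => k4.
have [e [f ef1]] : exists e f, form e f = 1.
  have e0 : vpick {:V} != 0 by rewrite vpick0 -dimv_eq0 dimV; lia.
  have /existsNP[f /eqP f0] : ~ forall v, form (vpick {:V}) v = 0.
    by move=> /form_nd/eqP; exact/negP.
  exists (vpick {:V}), ((form (vpick {:V}) f)^-1 *: f).
  by rewrite linearZr_LR /= mulVf.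
(* The size [n.-1] leaves room for one vector of the plane [<e, f>] to complete a Lagrangian
   basis. *)
have [|w [wsize wfree wiso wef]] :=
  @isotropic_extension _ _ form form_alt [:: e; f] n.-1.
  by rewrite dimV /=; lia.
pose s t j := four_lines e f t j :: w.
have ssize t j : size (s t j) = n by rewrite /= wsize prednK.
pose A t : k.-tuple (seq {vspace V}) :=
  [tuple comp_flag form (s t j) (tnth d j) | j < k].
have AP t : SpFl_prod form d (A t).
  move=> j; rewrite tnth_mktuple.
  have [ab ab0 abE] := four_lines_plane e f t j.
  apply: SpFl_comp_flag; rewrite ?ssize // /s abE.
    exact: (plane_vec_free form_alt ef1).
  exact: (plane_vec_isotropic form_alt).
apply: (@infinite_closedField F).
(* By injectivity, finitely many orbits would leave finitely many parameters [t]. *)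
suff Ainj : injective (fun t => Sp_orbit form (A t)).
  have := finite_preimage (in2W Ainj) d_fin.
  by apply: sub_finite_set => t _ /=; exists (A t).
move=> t' t /= tt'.
(* As [A t'] lies in its own orbit, equality of orbits yields [g] in [Sp] carrying [A t] to
   [A t']. *)
have : Sp_orbit form (A t') (A t') by exact: Sp_orbit_refl.
rewrite tt' => -[g [_ gform] gA]; apply/esym.
apply: (four_lines_eq form_alt ef1 wiso wef gform) => j jlt.
pose j' := Ordinal (leq_trans jlt k4).
have [i ile /andP[r0 rn]] :=
  symmetric_partial_sum hn (d_comp j') (d_sym j') (d_nontriv j').
have := congr1 (fun T => nth 0%VS (tnth T j') i) gA.
rewrite !tnth_mktuple (nth_map 0%VS) ?size_mkseq // !nth_mkseq //.
by apply: line_preserved; rewrite r0 wsize prednK.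
Qed.
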